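(* Let $1\le p\le\infty$ and $k>0$. Then the measure $$\rho\big(\mathcal N(L_{\mathcal G})\big)=k\,\big(\zeta_{\mathcal G}(p)\big)^{1/p},\qquad \mathcal N(L_{\mathcal G})\in\mathfrak N(x_0),$$ (interpreted for $p=\infty$ as $k\lim_{p\to\infty}(\zeta_{\mathcal G}(p))^{1/p}=k/\lambda_2$) is an orthogonally invariant convex systemic measure on $\mathfrak N(x_0)$.
   Context: Fix $n\ge 2$. All graphs are finite, simple, undirected, connected, on $n$ nodes, with positive edge weights: $\mathcal G=(V(\mathcal G),E(\mathcal G),w)$, $w:E(\mathcal G)\to(0,\infty)$. The Laplacian is $L_{\mathcal G}=\Delta-A$, where $A=[a_{ij}]$ has $a_{ij}=w(e)$ if $e=\{i,j\}\in E(\mathcal G)$ and $a_{ij}=0$ otherwise, and $\Delta=\mathrm{diag}(d_1,\dots,d_n)$ with $d_i=\sum_{e=\{i,j\}\in E(\mathcal G)}w(e)$. Its eigenvalues are $0=\lambda_1\le\lambda_2\le\dots\le\lambda_n$ (with $\lambda_2>0$ by connectedness). $L^\dagger$ is the Moore–Penrose pseudo-inverse, and $\preceq$ is the positive semidefinite order. Let $M_n=I_n-\frac1n\mathbf 1_n\mathbf 1_n^T$. The linear consensus network $\mathcal N(L_{\mathcal G})$ is the system $\dot x=-L_{\mathcal G}x+\xi$, $y=M_nx$, with input $\xi$, output $y$ and fixed initial condition $x_0$; $\mathfrak N(x_0)$ is the set of all such networks (with $\mathcal G$ ranging over the graphs above). For $\alpha>0$, $\alpha\,\mathcal N(L_{\mathcal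 G})=\mathcal N(\alpha L_{\mathcal G})$. The spectral zeta function is $\zeta_{\mathcal G}(p)=\sum_{\lambda_i\ne0}\lambda_i^{-p}$ for real $p$. A convex systemic measure is a map $\rho:\mathfrak N(x_0)\to\mathbb R$ such that for all $\mathcal N(L_{\mathcal G_1}),\mathcal N(L_{\mathcal G_2})\in\mathfrak N(x_0)$: (i) (positive homogeneity of degree $-1$) $\rho(\kappa\,\mathcal N(L_{\mathcal G_1}))=\kappa^{-1}\rho(\mathcal N(L_{\mathcal G_1}))$ for all $\kappa>0$; (ii) (monotonicity) if $L_{\mathcal G_1}^\dagger\preceq L_{\mathcal G_2}^\dagger$ then $\rho(\mathcal N(L_{\mathcal G_1}))\le\rho(\mathcal N(L_{\mathcal G_2}))$; (iii) (convexity) $\rho(\mathcal N(\alpha L_{\mathcal G_1}+(1-\alpha)L_{\mathcal G_2}))\le\alpha\rho(\mathcal N(L_{\mathcal G_1}))+(1-\alpha)\rho(\mathcal N(L_{\mathcal G_2}))$ for all $0\le\alpha\le1$. $\rho$ is orthogonally invariant if $\rho(\mathcal N(L_{\mathcal G}))=\rho(\mathcal N(UL_{\mathcal G}U^T))$ for all orthogonal $U$ ($UU^T=U^TU=I_n$) for which $\mathcal N(UL_{\mathcal G}U^T)\in\mathfrak N(x_0)$, i.e. for which $UL_{\mathcal G}U^T$ is again the Laplacian of such a graph. *)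

(* Defs.v *)
From HB Require Import structures.
From mathcomp Require Import all_boot all_order all_algebra.
From mathcomp Require Import all_classical all_reals all_analysis.
From mathcomp Require Import complex.
Set Implicit Arguments.
Unset Strict Implicit.
Unset Printing Implicit Defensive.
Import Order.TTheory GRing.Theory Num.Theory.
Import numFieldNormedType.Exports.
Local Open Scope classical_set_scope.
Local Open Scope ring_scope.

(* Only the values of [weight] on [edges] matter. *)
Record wgraph (R : realType) (n : nat) := WGraph {
  edges : {set {set 'I_n}};
  weight : {set 'I_n} -> R;
  edges_card2 : forall e, e \in edges -> #|e| = 2%N;
  edges_connected : forall i j : 'I_n,
    connect (fun u v => [set u; v]%SET \in edges) i j;
  weight_gt0 : forall e, e \in edges -> 0 < weight e }.

Section LinearAlgebra.
Variables (R : realType) (n : nat).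
Implicit Types A B P U : 'M[R]_n.

(* The eigenvalues of [A], repeated according to multiplicity, in nondecreasing
   order. [eigvals A] is meaningful when all the complex eigenvalues of [A] are
   real, in particular when [A] is symmetric: see [eigvalsP]. *)
Definition is_eigvals A (s : seq R) : Prop :=
  sorted <=%R s /\ char_poly A = \prod_(a <- s) ('X - a%:P).

Definition eigvals A : seq R := xget [::] [set s | is_eigvals A s].

Definition is_pseudoinverse A P : Prop :=
  [/\ A *m P *m A = A, P *m A *m P = P,
      (A *m P)^T = A *m P & (P *m A)^T = P *m A].

(* Exists and is unique for every [A]: see [pseudoinverseP]. *)
Definition pseudoinverse A : 'M[R]_n := xget 0 [set P | is_pseudoinverse A P].

Definition possemidef A : Prop :=
  A^T = A /\ forall x : 'cV[R]_n, 0 <= (x^T *m A *m x) 0 0.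

Definition psd_le A B : Prop := possemidef (B - A).

Definition orthogonal_mx U : Prop := U *m U^T = 1%:M /\ U^T *m U = 1%:M.

End LinearAlgebra.

Section Graphs.
Variables (R : realType) (n : nat).
Implicit Types G : wgraph R n.

Definition adjacency G : 'M[R]_n :=
  \matrix_(i, j) (if [set i; j]%SET \in edges G then weight G [set i; j]%SET
                  else 0).

Definition degree G (i : 'I_n) : R := \sum_(e in edges G | i \in e) weight G e.

Definition laplacian G : 'M[R]_n :=
  diag_mx (\row_i degree G i) - adjacency G.

Definition lambda2 G : R := nth 0 (eigvals (laplacian G)) 1.

Definition zeta G (p : R) : R :=
  \sum_(l <- eigvals (laplacian G) | l != 0) l `^ (- p).

(* (zeta_G(p))^(1/p) for p in [1, +oo]; the value at [-oo] is irrelevant. *)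
Definition zeta_root G (p : \bar R) : R :=
  match p with
  | r%:E => zeta G r `^ r^-1
  | +oo%E => lim (zeta G q `^ q^-1 @[q --> +oo])
  | -oo%E => 0
  end.

End Graphs.

(* dx/dt = sys_A x + sys_B xi, y = sys_C x, x(0) = sys_init *)
Record linsys (R : realType) (n : nat) := LinSys {
  sys_A : 'M[R]_n;
  sys_B : 'M[R]_n;
  sys_C : 'M[R]_n;
  sys_init : 'cV[R]_n }.

Section Networks.
Variables (R : realType) (n : nat) (x0 : 'cV[R]_n).

Definition centering : 'M[R]_n :=
  1%:M - n%:R^-1 *: ((const_mx 1 : 'cV[R]_n) *m (const_mx 1 : 'cV[R]_n)^T).

Definition network (L : 'M[R]_n) : linsys R n := LinSys (- L) 1%:M centering x0.

Definition networks : set (linsys R n) :=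
  [set N | exists G : wgraph R n, N = network (laplacian G)].

(* A measure is a map defined on [networks]; it is represented by a function
   [rho] on all linear systems, of which only the values on [networks] matter:
   every [network] at which the clauses below evaluate [rho] is in [networks],
   since positive multiples and convex combinations of Laplacians of connected
   graphs are again such Laplacians. *)
Definition homogeneous (rho : linsys R n -> R) : Prop :=
  forall (G : wgraph R n) (kappa : R), 0 < kappa ->
    rho (network (kappa *: laplacian G))
    = kappa^-1 * rho (network (laplacian G)).

Definition monotone (rho : linsys R n -> R) : Prop :=
  forall G1 G2 : wgraph R n,
    psd_le (pseudoinverse (laplacian G1)) (pseudoinverse (laplacian G2)) ->
    rho (network (laplacian G1)) <= rho (network (laplacian G2)).

Definition convex_measure (rho : linsys R n -> R) : Prop :=
  forall (G1 G2 : wgraph R n) (alpha : R), 0 <= alpha <= 1 ->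
    rho (network (alpha *: laplacian G1 + (1 - alpha) *: laplacian G2))
    <= alpha * rho (network (laplacian G1))
       + (1 - alpha) * rho (network (laplacian G2)).

Definition convex_systemic_measure (rho : linsys R n -> R) : Prop :=
  [/\ homogeneous rho, monotone rho & convex_measure rho].

Definition orthogonally_invariant (rho : linsys R n -> R) : Prop :=
  forall (G : wgraph R n) (U : 'M[R]_n), orthogonal_mx U ->
    networks (network (U *m laplacian G *m U^T)) ->
    rho (network (laplacian G)) = rho (network (U *m laplacian G *m U^T)).

End Networks.

Section Facts.
Variables (R : realType).

Lemma dotmx_eq0 m (x : 'cV[R]_m) : x^T *m x = 0 -> x = 0.
Proof.
move=> /matrixP/(_ 0 0); rewrite !mxE => /eqP.
rewrite psumr_eq0; last by move=> i _; rewrite !mxE -expr2 sqr_ge0.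
move=> /allP h; apply/matrixP => i j; rewrite ord1 !mxE.
by have := h i (mem_index_enum _); rewrite !mxE mulf_eq0 orbb => /eqP.
Qed.

Lemma gram_unit m r (C : 'M[R]_(m, r)) : row_free C^T -> C^T *m C \in unitmx.
Proof.
move=> Cfree; rewrite -row_free_unit -kermx_eq0; apply/eqP/row_matrixP => i.
rewrite row0; set v := row i _.
have hv : v *m (C^T *m C) = 0 by apply/sub_kermxP; exact: row_sub.
have: (C *m v^T)^T *m (C *m v^T) = 0.
  by rewrite trmx_mul trmxK mulmxA -(mulmxA v) hv mul0mx.
move/dotmx_eq0/(congr1 trmx); rewrite trmx_mul trmxK trmx0 => h.
by apply: (row_free_inj Cfree); rewrite h mul0mx.
Qed.

Lemma pseudoinverse_uniq n (A P Q : 'M[R]_n) :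
  is_pseudoinverse A P -> is_pseudoinverse A Q -> P = Q.
Proof.
move=> [P1 P2 P3 P4] [Q1 Q2 Q3 Q4].
have e1 : A *m P = A *m Q.
  by rewrite -[in LHS]Q1 -(mulmxA _ A) -Q3 -P3 -trmx_mul mulmxA P1.
have e2 : P *m A = Q *m A.
  rewrite -[in LHS]Q1 -(mulmxA A) mulmxA -P4 -Q4 -trmx_mul -mulmxA.
  by rewrite (mulmxA A P) P1.
by rewrite -P2 -mulmxA e1 mulmxA e2 Q2.
Qed.

Lemma pseudoinverseP n (A : 'M[R]_n) : is_pseudoinverse A (pseudoinverse A).
Proof.
suff [P hP] : exists P, is_pseudoinverse A P.
  exact: (xgetI 0 (hP : [set P | is_pseudoinverse A P] P)).
have [r [C [B [AE uC uB]]]] : exists r (C : 'M[R]_(n, r)) (B : 'M[R]_(r, n)),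
    [/\ A = C *m B, C^T *m C \in unitmx & B *m B^T \in unitmx].
  exists (\rank A), (col_base A), (row_base A); split.
  - by rewrite mulmx_base.
  - by apply: gram_unit; rewrite /row_free mxrank_tr; exact: col_base_full.
  - rewrite -{1}[row_base A]trmxK; apply: gram_unit; rewrite trmxK.
    exact: row_base_free.
pose IC := invmx (C^T *m C); pose IB := invmx (B *m B^T).
have sC : IC^T = IC by rewrite /IC trmx_inv trmx_mul trmxK.
have sB : IB^T = IB by rewrite /IB trmx_inv trmx_mul trmxK.
pose P := B^T *m IB *m IC *m C^T.
have BP : B *m P = IC *m C^T by rewrite /P !mulmxA mulmxV// mul1mx.
have PC : P *m C = B^T *m IB by rewrite /P -!mulmxA mulVmx// mulmx1.
exists P; split.
- rewrite AE -(mulmxA C B P) BP -(mulmxA C) -(mulmxA IC) (mulmxA C^T).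
  by rewrite (mulmxA IC) mulVmx// mul1mx.
- by rewrite AE (mulmxA P C B) PC -(mulmxA _ B P) BP /P !mulmxA.
- by rewrite AE -(mulmxA C B P) BP !trmx_mul trmxK sC mulmxA.
- by rewrite AE (mulmxA P C B) PC !trmx_mul trmxK sB mulmxA.
Qed.

Lemma eigvalsP n (A : 'M[R]_n) : A^T = A -> is_eigvals A (eigvals A).
Proof.
move=> Asym; pose f : {rmorphism R -> R[i]} := real_complex R.
suff [s hs] : exists s, char_poly A = \prod_(a <- s) ('X - a%:P).
  apply: (@xgetPex _ [::] [set s | is_eigvals A s]).
  exists (sort <=%R s); split.
    exact: sort_le_sorted.
  by rewrite hs; apply: perm_big; rewrite perm_sym perm_sort.
have Aher : map_mx f A \is hermsymmx.
  apply: realsym_hermsym.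
    apply/is_hermitianmxP; rewrite expr0 scale1r map_mx_id//.
    by rewrite -[in LHS]Asym map_trmx.
  by apply/mxOverP => i j; rewrite mxE; apply/complex_realP; exists (A i j).
have /orthomx_spectralP := hermitian_normalmx Aher.
set P := spectralmx _; set d := spectral_diag _ => AE.
have dreal j : d 0 j \is Num.real.
  by have /mxOverP := hermitian_spectral_diag_real Aher; apply.
have Pu : P \in unitmx by exact: spectral_unit.
have PA : P *m map_mx f A = diag_mx d *m P.
  by rewrite AE -mulmxA mulKVmx.
have charE : char_poly (map_mx f A) = \prod_(i < n) ('X - (d 0 i)%:P).
  transitivity (\prod_(i < n) ('X - (diag_mx d i i)%:P)); last first.
    by apply: eq_bigr => i _; rewrite mxE eqxx mulr1n.
  rewrite -char_poly_trig; last exact: diag_mx_is_trig.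
  have polyPu : map_mx polyC P \in unitmx.
    by rewrite unitmxE det_map_mx rmorph_unit// -unitmxE.
  have cPA : map_mx polyC P *m char_poly_mx (map_mx f A)
           = char_poly_mx (diag_mx d) *m map_mx polyC P.
    rewrite /char_poly_mx mulmxBr mulmxBl -!map_mxM PA.
    by rewrite scalar_mxC.
  move: (congr1 determinant cPA); rewrite !det_mulmx [RHS]mulrC.
  by apply: mulrI; rewrite -unitmxE.
exists [seq complex.Re (d 0 i) | i <- enum 'I_n].
apply: (map_poly_inj f); rewrite map_char_poly charE rmorph_prod big_map.
rewrite -big_enum /=; apply: eq_bigr => i _.
by rewrite rmorphB /= map_polyX map_polyC /= RRe_real.
Qed.

End Facts.

(* Main.v *)
(* For L = U^T diag(d) U positive semidefinite with pseudo-inverse P and q >= 1,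
   zeta(q)^(1/q) is the l^q norm of the diagonal of U P U^T, and by Peierls'
   inequality it bounds that norm when U is replaced by any orthogonal matrix.
   Monotonicity follows by comparing the diagonals of P1 and P2 in an eigenbasis
   of L1. For convexity take an eigenbasis (u_i) of a L1 + b L2, with eigenvalues
   d_i: since 0 <= (u - t L1 u)^T P1 (u - t L1 u), and likewise for L2, the choice
   t = 1/d_i gives 1/d_i <= a u_i^T P1 u_i + b u_i^T P2 u_i, and Minkowski's
   inequality concludes. The case p = oo is obtained by letting q tend to
   infinity, the limit being squeezed between 1/lambda_2 and n^(1/q)/lambda_2. *)
Require Import Defs.
From mathcomp Require Import all_boot all_order all_algebra.
From mathcomp Require Import all_classical all_reals all_analysis.
From mathcomp Require Import ring lra.
Import Order.TTheory GRing.Theory Num.Theory.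
Import numFieldNormedType.Exports.
Local Open Scope classical_set_scope.
Local Open Scope ring_scope.

Set Implicit Arguments.
Unset Strict Implicit.
Unset Printing Implicit Defensive.

(** * Power means *)

Section PowerMean.
Context {R : realType}.
Implicit Types (p c t : R) (I : finType).

Lemma ln_ge1Bx t : 0 < t -> 1 - t^-1 <= ln t.
Proof.
move=> t0; have := expR_ge1Dx (- ln t).
rewrite expRN lnK ?posrE//; lra.
Qed.

(** For positive [t], factor t^p = t * t^(p-1) and bound t^(p-1) = exp((p-1) ln t) from below by 1 +
    (p-1) ln t, then use ln t >= 1 - 1/t. *)
Lemma powR_bernoulli p t : 1 <= p -> 0 <= t -> 1 + p * (t - 1) <= t `^ p.
Proof.
move=> p1; rewrite le_eqVlt => /predU1P[<-|t0].
  by rewrite powR0; [lra|apply/eqP; lra].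
rewrite -[p in X in _ <= X](subrK 1) powRD; last by rewrite (gt_eqF t0) implybT.
rewrite powRr1 ?(ltW t0)//.
have -> : t `^ (p - 1) = expR ((p - 1) * ln t) by rewrite /powR gt_eqF.
have h : 1 + (p - 1) * (1 - t^-1) <= expR ((p - 1) * ln t).
  apply: le_trans (expR_ge1Dx _); rewrite lerD2l ler_wpM2l ?subr_ge0//.
  exact: ln_ge1Bx.
apply: le_trans (ler_wpM2r (ltW t0) h).
have -> : (1 + (p - 1) * (1 - t^-1)) * t = t + (p - 1) * (t - 1).
  by field; rewrite gt_eqF.
lra.
Qed.

Lemma powR_jensen I p (s x : I -> R) : 1 <= p ->
  (forall j, 0 <= s j) -> \sum_j s j = 1 -> (forall j, 0 <= x j) ->
  (\sum_j s j * x j) `^ p <= \sum_j s j * x j `^ p.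
Proof.
move=> p1 s0 s1 x0; set c := \sum_j s j * x j.
have : 0 <= c by apply: sumr_ge0 => j _; exact: mulr_ge0.
rewrite le_eqVlt => /predU1P[<-|c0].
  rewrite powR0; first by apply: sumr_ge0 => j _; rewrite mulr_ge0// powR_ge0.
  by apply/eqP; lra.
(* The mean [c] makes the linear terms cancel, so c^p is the average of the tangent at [c] evaluated
   at the points [x j]; Bernoulli then applies termwise. *)
have -> : c `^ p = \sum_j s j * (c `^ p * (1 + p * (x j / c - 1))).
  transitivity (c `^ p * ((1 - p) * (\sum_j s j) + p * c^-1 * c)).
    by rewrite s1 -mulrA mulVf ?gt_eqF//; ring.
  rewrite /c !mulr_sumr -/c -big_split /= mulr_sumr.
  by apply: eq_bigr => j _; ring.
apply: ler_sum => j _; apply: ler_wpM2l => //.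
have -> : x j = c * (x j / c) by rewrite mulrC divfK// gt_eqF.
rewrite powRM ?(ltW c0) ?divr_ge0 ?(ltW c0)//.
rewrite (mulrC c) mulfK ?gt_eqF// ler_wpM2l ?powR_ge0//.
by apply: powR_bernoulli; rewrite // divr_ge0// ltW.
Qed.

Lemma powR_convex2 p (a b x y : R) : 1 <= p -> 0 <= a -> 0 <= b -> a + b = 1 ->
  0 <= x -> 0 <= y -> (a * x + b * y) `^ p <= a * x `^ p + b * y `^ p.
Proof.
move=> p1 a0 b0 ab1 x0 y0.
have := @powR_jensen bool p (fun i => if i then a else b)
  (fun i => if i then x else y) p1.
by rewrite !big_bool; apply=> // -[].
Qed.

(** No absolute values are taken: only families of nonnegative reals occur below. *)
Definition lpnorm I p (x : I -> R) : R := (\sum_i x i `^ p) `^ p^-1.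

Lemma lpnorm_ge0 I p (x : I -> R) : 0 <= lpnorm p x.
Proof. exact: powR_ge0. Qed.

Lemma lpnormK I p (x : I -> R) : p != 0 -> lpnorm p x `^ p = \sum_i x i `^ p.
Proof.
move=> p0; rewrite -powRrM mulVf// powRr1//.
by apply: sumr_ge0 => i _; exact: powR_ge0.
Qed.

Lemma le_lpnorm I p (x y : I -> R) : 0 <= p -> (forall i, 0 <= x i) ->
  (forall i, x i <= y i) -> lpnorm p x <= lpnorm p y.
Proof.
move=> p0 x0 xy; have y0 i : 0 <= y i := le_trans (x0 i) (xy i).
have sumge0 (z : I -> R) : \sum_i z i `^ p \in Num.nneg.
  by rewrite nnegrE; apply: sumr_ge0 => i _; exact: powR_ge0.
apply: ge0_ler_powR; rewrite ?invr_ge0//.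
by apply: ler_sum => i _; apply: ge0_ler_powR => //; rewrite nnegrE.
Qed.

Lemma lpnormZ I p a (x : I -> R) : p != 0 -> 0 <= a -> (forall i, 0 <= x i) ->
  lpnorm p (fun i => a * x i) = a * lpnorm p x.
Proof.
move=> p0 a0 x0; rewrite /lpnorm.
under eq_bigr => i _ do rewrite powRM//.
rewrite -mulr_sumr powRM ?powR_ge0//; last first.
  by apply: sumr_ge0 => i _; exact: powR_ge0.
by rewrite -powRrM mulfV// powRr1.
Qed.

Lemma lpnorm_eq0 I p (x : I -> R) : 0 < p -> (forall i, 0 <= x i) ->
  lpnorm p x = 0 -> forall i, x i = 0.
Proof.
move=> p0 x0 /powR_eq0_eq0 /eqP; rewrite psumr_eq0; last first.
  by move=> i _; exact: powR_ge0.
by move=> /allP h i; have /implyP/(_ isT)/eqP/powR_eq0_eq0 := h i (mem_index_enum _).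
Qed.

(** Minkowski's inequality from convexity of the power: (x_i + y_i)/(X + Y) is the convex
    combination of x_i/X and y_i/Y with weights X/(X + Y) and Y/(X + Y), and both normalized
    families have p-th powers summing to 1. *)
Lemma lpnormD_gt0 I p (x y : I -> R) X Y : 1 <= p ->
  (forall i, 0 <= x i) -> (forall i, 0 <= y i) -> 0 < X -> 0 < Y ->
  X `^ p = \sum_i x i `^ p -> Y `^ p = \sum_i y i `^ p ->
  lpnorm p (fun i => x i + y i) <= X + Y.
Proof.
move=> p1 x0 y0 X0 Y0 XE YE; have p0 : 0 < p by lra.
have pn0 : p != 0 by rewrite gt_eqF.
have Z0 : 0 < X + Y by exact: addr_gt0.
have normalize c z : 0 < c -> 0 <= z -> z `^ p = c `^ p * (z / c) `^ p.
  move=> c0 z0; rewrite -powRM ?divr_ge0 ?(ltW c0)//.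
  by rewrite mulrC divfK// gt_eqF.
have sum1 c (z : I -> R) : 0 < c -> (forall i, 0 <= z i) ->
    c `^ p = \sum_i z i `^ p -> \sum_i (z i / c) `^ p = 1.
  move=> c0 z0 cE; apply: (mulfI (x := c `^ p)); first by rewrite gt_eqF ?powR_gt0.
  by rewrite mulr1 mulr_sumr {2}cE; apply: eq_bigr => i _; rewrite -normalize.
rewrite -[leRHS](@powRr1 _ (X + Y)) ?(ltW Z0)// -(mulfV pn0) powRrM.
apply: ge0_ler_powR; rewrite ?invr_ge0 ?(ltW p0) ?nnegrE ?powR_ge0//.
  by apply: sumr_ge0 => i _; exact: powR_ge0.
have -> : (X + Y) `^ p = \sum_i (X + Y) `^ p *
    (X / (X + Y) * (x i / X) `^ p + Y / (X + Y) * (y i / Y) `^ p).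
  rewrite -mulr_sumr big_split /= -!mulr_sumr !sum1// !mulr1 -mulrDl.
  by rewrite mulfV ?gt_eqF// mulr1.
apply: ler_sum => i _; rewrite (normalize (X + Y)) ?addr_ge0//.
rewrite ler_wpM2l ?powR_ge0//.
have -> : (x i + y i) / (X + Y)
        = X / (X + Y) * (x i / X) + Y / (X + Y) * (y i / Y).
  by field; rewrite !gt_eqF.
apply: powR_convex2; rewrite ?divr_ge0// ?(ltW X0) ?(ltW Y0) ?(ltW Z0)//.
by rewrite -mulrDl mulfV// gt_eqF.
Qed.

Lemma lpnormD I p (x y : I -> R) : 1 <= p ->
  (forall i, 0 <= x i) -> (forall i, 0 <= y i) ->
  lpnorm p (fun i => x i + y i) <= lpnorm p x + lpnorm p y.
Proof.
move=> p1 x0 y0; have p0 : 0 < p by lra.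
have pn0 : p != 0 by rewrite gt_eqF.
(* A zero norm rules out the normalization, but then the whole family vanishes. *)
have := lpnorm_ge0 p x; rewrite le_eqVlt => /predU1P[/esym X0|X0].
  rewrite X0 add0r; have xE := lpnorm_eq0 p0 x0 X0.
  by apply: le_lpnorm => [|i|i]; rewrite ?(ltW p0)// xE add0r.
have := lpnorm_ge0 p y; rewrite le_eqVlt => /predU1P[/esym Y0|Y0].
  rewrite Y0 addr0; have yE := lpnorm_eq0 p0 y0 Y0.
  by apply: le_lpnorm => [|i|i]; rewrite ?(ltW p0)// yE addr0.
exact: (lpnormD_gt0 p1 x0 y0 X0 Y0 (lpnormK x pn0) (lpnormK y pn0)).
Qed.

Lemma cvg_powR_inv c : 0 < c -> c `^ q^-1 @[q --> +oo] --> (1 : R).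
Proof.
move=> c0; have -> : (fun q => c `^ q^-1) = (fun q : R => expR (q^-1 * ln c)).
  by apply/funext => q; rewrite /powR gt_eqF.
rewrite -[X in _ --> X]expR0 -(mul0r (ln c)).
apply: (continuous_cvg _ (@continuous_expR R _)).
apply: cvgMr_tmp.
apply/cvgrPdist_lt => e e0; near=> q.
have q0 : 0 < q by near: q; exact: nbhs_pinfty_gt.
rewrite sub0r normrN gtr0_norm ?invr_gt0// invf_plt ?posrE//.
near: q; apply: nbhs_pinfty_gt; exact: num_real.
Unshelve. all: by end_near.
Qed.

End PowerMean.

(** * The spectral theorem for real symmetric matrices *)

Section SpectralTheorem.
Context {R : realType}.

Lemma orthogonal_mxP n (U : 'M[R]_n) : U *m U^T = 1%:M -> orthogonal_mx U.
Proof. by move=> h; split=> //; exact: mulmx1C. Qed.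

(** [H] is the reflection in the hyperplane orthogonal to w = v - e. Since |w|^2 = 2(1 - v_0), its
    usual factor 2/|w|^2 is 1/c with c = 1 - v_0; when v = e there is nothing to reflect. *)
Lemma householder n (v : 'rV[R]_n.+1) : v *m v^T = 1%:M ->
  exists H : 'M[R]_n.+1,
    [/\ H^T = H, H *m H = 1%:M & v *m H = delta_mx 0 0].
Proof.
move=> v1; pose e : 'rV[R]_n.+1 := delta_mx 0 0.
have [->|vNe] := eqVneq v e.
  by exists 1%:M; rewrite trmx1 !mulmx1.
pose w := v - e.
have e1 : e *m e^T = 1%:M.
  by rewrite /e trmx_delta mul_delta_mx; apply/matrixP => i j; rewrite !ord1 !mxE.
have ve : v *m e^T = (v 0 0)%:M.
  rewrite /e trmx_delta; apply/matrixP => i j; rewrite !ord1 !mxE eqxx mulr1n.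
  rewrite (bigD1 0)//= mxE !eqxx mulr1 big1 ?addr0// => k k0.
  by rewrite mxE (negbTE k0) mulr0.
have ev : e *m v^T = (v 0 0)%:M by rewrite -[LHS]trmxK trmx_mul trmxK ve tr_scalar_mx.
pose c := 1 - v 0 0.
have ww : w *m w^T = (2 * c)%:M.
  rewrite /w linearB /= mulmxBl !mulmxBr v1 ve ev e1.
  by rewrite -!raddfB /=; congr (_%:M); rewrite /c; ring.
have vw : v *m w^T = c%:M.
  by rewrite /w linearB /= mulmxBr v1 ve -raddfB.
have c0 : c != 0.
  apply: contra_neq vNe => c0; apply/eqP; rewrite -subr_eq0 -/w.
  apply/eqP; rewrite -[w]trmxK; apply/eqP; rewrite trmx_eq0; apply/eqP.
  by apply: dotmx_eq0; rewrite trmxK ww c0 mulr0 raddf0.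
pose H := 1%:M - c^-1 *: (w^T *m w).
exists H; split.
- by rewrite /H linearB /= linearZ /= trmx1 trmx_mul trmxK.
- have PH : (w^T *m w) *m H = - (w^T *m w).
    rewrite /H mulmxBr mulmx1 -scalemxAr -mulmxA (mulmxA w) ww mul_scalar_mx.
    rewrite -scalemxAr scalerA (_ : c^-1 * (2 * c) = 2); last by field.
    by rewrite scaler_nat mulr2n opprD addrA subrr sub0r.
  by rewrite {1}/H mulmxBl mul1mx -scalemxAl PH scalerN opprK /H subrK.
- rewrite /H mulmxBr mulmx1 -scalemxAr mulmxA vw mul_scalar_mx scalerA.
  by rewrite mulVf// scale1r /w opprB addrC subrK.
Qed.

Lemma symmetric_unit_eigenvector n (A : 'M[R]_n.+1) : A^T = A ->
  exists a (v : 'rV[R]_n.+1), v *m A = a *: v /\ v *m v^T = 1%:M.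
Proof.
move=> Asym; have [_] := eigvalsP Asym.
(* By [eigvalsP] the characteristic polynomial splits over the reals, so any entry of the list is an
   eigenvalue; an empty list would make this polynomial constant. *)
case: (eigvals A) => [|a s] cE.
  have := size_char_poly A; by rewrite cE big_nil size_poly1.
have /eigenvalueP[v vA v0] : eigenvalue A a.
  by rewrite eigenvalue_root_char cE big_cons rootM root_XsubC eqxx.
pose q := (v *m v^T) 0 0.
have vv : v *m v^T = q%:M by rewrite [LHS]mx11_scalar.
have q0 : 0 < q.
  rewrite lt_neqAle eq_sym; apply/andP; split.
    apply: contra_neq v0 => q0; apply/eqP; rewrite -trmx_eq0; apply/eqP.
    by apply: dotmx_eq0; rewrite trmxK vv q0 raddf0.
  by rewrite /q mxE; apply: sumr_ge0 => i _; rewrite mxE -expr2 sqr_ge0.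
exists a, ((Num.sqrt q)^-1 *: v); split.
  by rewrite -scalemxAl vA !scalerA mulrC.
rewrite linearZ /= -scalemxAl -scalemxAr scalerA vv -expr2 exprVn sqr_sqrtr ?ltW//.
by rewrite scale_scalar_mx mulVf// gt_eqF.
Qed.

(** Deflation by induction on the size: a reflection sends a unit eigenvector to the first basis
    vector, after which the matrix is block diagonal. *)
Lemma symmetric_spectral n (A : 'M[R]_n) : A^T = A ->
  exists (U : 'M[R]_n) (d : 'rV[R]_n),
    orthogonal_mx U /\ A = U^T *m diag_mx d *m U.
Proof.
elim: n A => [|n IH] A Asym.
  exists 1%:M, 0; split; first by apply: orthogonal_mxP; rewrite trmx1 mulmx1.
  by apply/matrixP => -[].
have [a [v [vA v1]]] := symmetric_unit_eigenvector Asym.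
have [H [Hsym HH vH]] := householder v1.
pose B : 'M[R]_(1 + n) := H *m A *m H.
have Bsym : B^T = B by rewrite /B !trmx_mul Hsym Asym mulmxA.
have AE : A = H *m B *m H by rewrite /B !mulmxA HH mul1mx -mulmxA HH mulmx1.
have eB : (delta_mx 0 0 : 'rV[R]_(1 + n)) *m B = a *: delta_mx 0 0.
  by rewrite -vH /B !mulmxA -(mulmxA v) HH mulmx1 vA -scalemxAl.
have B0 j : B 0 j = a *+ (j == 0).
  have := congr1 (fun M : 'rV[R]__ => M 0 j) eB.
  by rewrite -rowE !mxE eqxx /= mulr_natr.
clearbody B; have lsh0 : lshift n (0 : 'I_1) = 0 by exact: val_inj.
(* The first row of [B] is known from the eigenvector equation; symmetry gives the first column. *)
have BE : B = block_mx a%:M 0 0 (drsubmx B).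
  rewrite -[LHS]submxK; congr block_mx; apply/matrixP => i j.
  - by rewrite !ord1 !mxE lsh0 B0 !eqxx.
  - by rewrite !ord1 !mxE lsh0 B0 -val_eqE.
  - by rewrite !ord1 !mxE -Bsym mxE lsh0 B0 -val_eqE.
have [|U' [d' [[U'1 U'2] B'E]]] := IH (drsubmx B).
  by rewrite trmx_drsub Bsym.
pose V : 'M[R]_(1 + n) := block_mx 1%:M 0 0 U'.
pose d : 'rV[R]_(1 + n) := row_mx a%:M d'.
have VV : V *m V^T = 1%:M.
  rewrite /V tr_block_mx !trmx0 trmx1 mulmx_block !mulmx0 !mul0mx mulmx1 !addr0 add0r.
  by rewrite U'1 -scalar_mx_block.
have VD : B = V^T *m diag_mx d *m V.
  rewrite /V /d diag_mx_row tr_block_mx !trmx0 trmx1 !mulmx_block.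
  rewrite !mulmx0 !mul0mx !mulmx1 !mul1mx !addr0 !add0r -B'E ?mul0mx [LHS]BE.
  congr block_mx.
  by apply/matrixP => i j; rewrite !ord1 !mxE.
exists (V *m H), d; split.
  by apply: orthogonal_mxP; rewrite trmx_mul Hsym mulmxA -(mulmxA V) HH mulmx1.
by rewrite AE VD trmx_mul Hsym !mulmxA.
Qed.

End SpectralTheorem.

(** * The spectral zeta function of a positive semidefinite matrix *)

Section MatrixZeta.
Context {R : realType} {n : nat}.
Implicit Types A P U V : 'M[R]_n.

Lemma char_poly_orthogonal A U : orthogonal_mx U ->
  char_poly (U *m A *m U^T) = char_poly A.
Proof.
move=> [UU _]; pose Up := map_mx (@polyC R) U.
have UpUp : Up *m Up^T = 1%:M by rewrite matrix.map_trmx -map_mxM UU map_mx1.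
rewrite /char_poly; have -> : char_poly_mx (U *m A *m U^T)
    = Up *m char_poly_mx A *m Up^T.
  rewrite /char_poly_mx mulmxBr mulmxBl !map_mxM -matrix.map_trmx; congr (_ - _).
  by rewrite scalar_mxC -mulmxA UpUp mulmx1.
by rewrite !det_mulmx mulrAC -det_mulmx UpUp det1 mul1r.
Qed.

(** [eigvals] is chosen from the characteristic polynomial alone, so the lists agree exactly and not
    just up to permutation. *)
Lemma eigvals_orthogonal A U : orthogonal_mx U ->
  eigvals (U *m A *m U^T) = eigvals A.
Proof. by move=> Uo; rewrite /eigvals /is_eigvals char_poly_orthogonal. Qed.

Lemma spectral_sym U (d : 'rV[R]_n) :
  (U^T *m diag_mx d *m U)^T = U^T *m diag_mx d *m U.
Proof. by rewrite !trmx_mul trmxK tr_diag_mx mulmxA. Qed.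

Lemma eigvals_spectral U (d : 'rV[R]_n) : orthogonal_mx U ->
  perm_eq (eigvals (U^T *m diag_mx d *m U)) [seq d 0 i | i <- enum 'I_n].
Proof.
move=> [UU1 UU2]; have [_] := eigvalsP (spectral_sym U d).
have := @char_poly_orthogonal (diag_mx d) U^T.
rewrite trmxK => -> => [cE|]; last by split; rewrite trmxK.
apply: prod_XsubC_eq; rewrite -cE char_poly_trig ?diag_mx_is_trig// big_map big_enum.
by apply: eq_bigr => i _; rewrite mxE eqxx.
Qed.

(** Stated for matrices so that the inequalities below can be proved without reference to graphs. *)
Definition mzeta A (q : R) : R := \sum_(l <- eigvals A | l != 0) l `^ (- q).

Lemma mzeta_spectral U (d : 'rV[R]_n) q : orthogonal_mx U -> q != 0 ->
  (forall i, 0 <= d 0 i) ->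
  mzeta (U^T *m diag_mx d *m U) q = \sum_i (d 0 i)^-1 `^ q.
Proof.
move=> Uo q0 d0; rewrite /mzeta (perm_big _ (eigvals_spectral d Uo)) /=.
rewrite big_map big_enum_cond big_mkcond /=; apply: eq_bigr => i _.
(* Zero eigenvalues may enter the right-hand sum: 0^-1 is 0 by convention and 0^q = 0 because [q] is
   nonzero. *)
have [->|di0] := eqVneq (d 0 i) 0; first by rewrite /= invr0 powR0.
by rewrite -powR_inv1// -powRrM mulN1r.
Qed.

Lemma spectral_psd U (d : 'rV[R]_n) : (forall i, 0 <= d 0 i) ->
  possemidef (U^T *m diag_mx d *m U).
Proof.
move=> d0; split=> [|x]; first exact: spectral_sym.
have -> : x^T *m (U^T *m diag_mx d *m U) *m x
        = (U *m x)^T *m diag_mx d *m (U *m x) by rewrite trmx_mul !mulmxA.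
rewrite mul_mx_diag mxE; apply: sumr_ge0 => i _.
by rewrite !mxE mulrAC -expr2 mulr_ge0// sqr_ge0.
Qed.

Lemma conj_diagE A V i : (V *m A *m V^T) i i = (row i V *m A *m (row i V)^T) 0 0.
Proof.
rewrite -row_mul [LHS]mxE [RHS]mxE; apply: eq_bigr => k _.
by congr (_ * _); rewrite !mxE.
Qed.

Lemma psd_row A (u : 'rV[R]_n) : possemidef A -> 0 <= (u *m A *m u^T) 0 0.
Proof. by move=> [_ /(_ u^T)]; rewrite trmxK. Qed.

Lemma psd_spectral A : possemidef A -> exists U (d : 'rV[R]_n),
  [/\ orthogonal_mx U, forall i, 0 <= d 0 i & A = U^T *m diag_mx d *m U].
Proof.
move=> Apsd; have [U [d [Uo AE]]] := symmetric_spectral Apsd.1.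
exists U, d; split=> // i; have := psd_row (row i U) Apsd.
rewrite -conj_diagE AE !mulmxA Uo.1 mul1mx -mulmxA Uo.1 mulmx1.
by rewrite mxE eqxx.
Qed.

(** The Penrose equations are checked entrywise on the diagonal; the convention 0^-1 = 0 is exactly
    what zero eigenvalues require. *)
Lemma pinv_spectral U (d : 'rV[R]_n) : orthogonal_mx U ->
  pseudoinverse (U^T *m diag_mx d *m U)
  = U^T *m diag_mx (\row_i (d 0 i)^-1) *m U.
Proof.
move=> [UU _]; set e := \row_i _; apply: (pseudoinverse_uniq (pseudoinverseP _)).
have mulE (a b : 'rV[R]_n) : (U^T *m diag_mx a *m U) *m (U^T *m diag_mx b *m U)
    = U^T *m diag_mx (\row_j (a 0 j * b 0 j)) *m U.
  by rewrite !mulmxA -(mulmxA _ U) UU mulmx1 -(mulmxA U^T) mulmx_diag.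
split; rewrite ?mulE ?spectral_sym//; congr (_ *m diag_mx _ *m _);
  apply/rowP => i; rewrite !mxE;
  by have [->|d0] := eqVneq (d 0 i) 0; rewrite ?invr0 ?mulr0 ?mul0r// ?mulfV// ?mulVf// mul1r.
Qed.

Lemma pinv_psd A : possemidef A -> possemidef (pseudoinverse A).
Proof.
move=> /psd_spectral[U [d [Uo d0 ->]]]; rewrite pinv_spectral//.
by apply: spectral_psd => i; rewrite mxE invr_ge0.
Qed.

(* Peierls' inequality: the squared entries of an orthogonal matrix are doubly
   stochastic, so that Jensen's inequality applies row by row. *)
Lemma lpnorm_conj_pinv A V q : possemidef A -> orthogonal_mx V -> 1 <= q ->
  lpnorm q (fun i => (V *m pseudoinverse A *m V^T) i i) <= mzeta A q `^ q^-1.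
Proof.
move=> /psd_spectral[U [d [Uo d0 ->]]] Vo q1.
have q0 : 0 < q by lra.
rewrite (pinv_spectral d Uo) (mzeta_spectral Uo (lt0r_neq0 q0) d0).
pose W := V *m U^T; have WE : V *m U^T = W by [].
have WT : W^T = U *m V^T by rewrite trmx_mul trmxK.
have Wo : orthogonal_mx W.
  by apply: orthogonal_mxP; rewrite WT /W mulmxA -(mulmxA V) Uo.2 mulmx1 Vo.1.
clearbody W; have rows i : \sum_j W i j ^+ 2 = 1.
  have /matrixP/(_ i i) := Wo.1; rewrite [RHS]mxE eqxx mulr1n [LHS]mxE => <-.
  by apply: eq_bigr => j _; rewrite [in RHS]mxE expr2.
have cols j : \sum_i W i j ^+ 2 = 1.
  have /matrixP/(_ j j) := Wo.2; rewrite [RHS]mxE eqxx mulr1n [LHS]mxE => <-.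
  by apply: eq_bigr => i _; rewrite [in RHS]mxE expr2.
have dE i : (V *m (U^T *m diag_mx (\row_i0 (d 0 i0)^-1) *m U) *m V^T) i i
    = \sum_j W i j ^+ 2 * (d 0 j)^-1.
  rewrite !mulmxA WE -mulmxA -WT mul_mx_diag mxE; apply: eq_bigr => j _.
  by rewrite [in LHS]mxE [W^T _ _]mxE mxE expr2 mulrAC.
rewrite /lpnorm; under eq_bigr => i _ do rewrite dE.
apply: ge0_ler_powR; rewrite ?invr_ge0 ?(ltW q0) ?nnegrE//.
- by apply: sumr_ge0 => i _; exact: powR_ge0.
- by apply: sumr_ge0 => i _; exact: powR_ge0.
apply: (@le_trans _ _ (\sum_i \sum_j W i j ^+ 2 * (d 0 j)^-1 `^ q)).
  apply: ler_sum => i _; apply: powR_jensen => // j; first exact: sqr_ge0.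
  by rewrite invr_ge0.
(* After Jensen along the rows, exchanging the sums leaves the column sums, which are also 1. *)
rewrite exchange_big /=; apply: ler_sum => j _.
by rewrite -mulr_suml cols mul1r.
Qed.

Lemma mzeta_lpnorm U (d : 'rV[R]_n) q : orthogonal_mx U -> 1 <= q ->
  (forall i, 0 <= d 0 i) ->
  mzeta (U^T *m diag_mx d *m U) q `^ q^-1 = lpnorm q (fun i => (d 0 i)^-1).
Proof. by move=> Uo q1 d0; rewrite mzeta_spectral// gt_eqF//; lra. Qed.

Lemma pinv_eigenrow U (d : 'rV[R]_n) i : orthogonal_mx U ->
  (U *m pseudoinverse (U^T *m diag_mx d *m U) *m U^T) i i = (d 0 i)^-1.
Proof.
move=> Uo; rewrite pinv_spectral// !mulmxA Uo.1 mul1mx -mulmxA Uo.1 mulmx1.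
by rewrite !mxE eqxx.
Qed.

Lemma le_mzeta_root A B q : possemidef A -> possemidef B -> 1 <= q ->
  psd_le (pseudoinverse A) (pseudoinverse B) ->
  mzeta A q `^ q^-1 <= mzeta B q `^ q^-1.
Proof.
move=> /psd_spectral[U [d [Uo d0 AE]]] Bpsd q1 AB.
(* Peierls for [B] in the eigenbasis of [A] reduces the claim to comparing two diagonals entry by
   entry. *)
apply: (le_trans _ (lpnorm_conj_pinv Bpsd Uo q1)).
rewrite [in leLHS]AE (mzeta_lpnorm Uo q1 d0); apply: le_lpnorm => [|i|i]; first by lra.
  by rewrite invr_ge0.
rewrite -(pinv_eigenrow d i Uo) -AE -subr_ge0.
have := psd_row (row i U) AB; rewrite -conj_diagE mulmxBr mulmxBl.
by rewrite mxE [X in _ + X]mxE.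
Qed.

(* The bound is [0 <= (u - t u A) P (u - t u A)^T] for [P] the pseudo-inverse. *)
Lemma pinv_quadratic_bound A (u : 'rV[R]_n) t : possemidef A ->
  u *m pseudoinverse A *m A = u ->
  t * (u *m u^T) 0 0 *+ 2 - t ^+ 2 * (u *m A *m u^T) 0 0
  <= (u *m pseudoinverse A *m u^T) 0 0.
Proof.
move=> Apsd uPA; set P := pseudoinverse A in uPA *.
have Ppsd : possemidef P by exact: pinv_psd.
have APu : A *m P *m u^T = u^T.
  by rewrite -{2}uPA !trmx_mul Apsd.1 Ppsd.1 mulmxA.
have := psd_row (u - t *: (u *m A)) Ppsd.
have -> : (u - t *: (u *m A)) *m P *m (u - t *: (u *m A))^T
    = u *m P *m u^T - t *: (u *m u^T) *+ 2 + t ^+ 2 *: (u *m A *m u^T).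
  have -> : (u - t *: (u *m A))^T = u^T - t *: (A *m u^T).
    by rewrite linearB /= linearZ /= trmx_mul Apsd.1.
  have uAPu : u *m A *m P *m u^T = u *m u^T by rewrite -!mulmxA (mulmxA A) APu.
  have uAPAu : u *m A *m P *m A *m u^T = u *m A *m u^T.
    by have [APA _ _ _] := pseudoinverseP A; rewrite -!(mulmxA u) APA.
  rewrite !mulmxBl !mulmxBr -!scalemxAl -!scalemxAr !mulmxA uPA uAPu uAPAu.
  by rewrite scalerA -expr2 mulr2n opprB opprD !addrA addrAC.
rewrite !mxE; lra.
Qed.

(** The kernel inclusions ensure that an eigenvector of [A] with nonzero eigenvalue lies in the row
    space of [A1] and of [A2], as [pinv_quadratic_bound] demands. *)
Lemma mzeta_root_convex A A1 A2 a b q : 1 <= q ->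
  possemidef A1 -> possemidef A2 -> 0 <= a -> 0 <= b -> a + b = 1 ->
  A = a *: A1 + b *: A2 ->
  (forall M : 'M[R]_n, A1 *m M = 0 -> A *m M = 0) ->
  (forall M : 'M[R]_n, A2 *m M = 0 -> A *m M = 0) ->
  mzeta A q `^ q^-1 <= a * mzeta A1 q `^ q^-1 + b * mzeta A2 q `^ q^-1.
Proof.
move=> q1 A1psd A2psd a0 b0 ab1 AE ker1 ker2.
have Apsd : possemidef A.
  split=> [|x]; first by rewrite AE linearD !linearZ /= A1psd.1 A2psd.1.
  rewrite AE mulmxDr mulmxDl -!scalemxAr -!scalemxAl.
  by rewrite mxE addr_ge0// mxE mulr_ge0// ?A1psd.2 ?A2psd.2.
have [U [d [Uo d0 AE']]] := psd_spectral Apsd.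
(* Take M = B^+ B - 1, which [B] annihilates, hence so does [A]. *)
have quot B : (forall M : 'M[R]_n, B *m M = 0 -> A *m M = 0) ->
    A *m pseudoinverse B *m B = A.
  move=> /(_ (pseudoinverse B *m B - 1%:M)).
  have [BPB _ _ _] := pseudoinverseP B.
  rewrite !mulmxBr !mulmx1 !mulmxA BPB subrr => /(_ erefl)/eqP.
  by rewrite subr_eq0 => /eqP.
pose f B i := (U *m pseudoinverse B *m U^T) i i.
have f_ge0 B i : possemidef B -> 0 <= f B i.
  by move=> /pinv_psd Ppsd; rewrite /f conj_diagE; exact: psd_row.
have rowA i : row i U *m A = d 0 i *: row i U.
  rewrite AE' !mulmxA -row_mul Uo.1 -row_mul mul1mx -row_mul mul_diag_mx.
  by apply/rowP => j; rewrite !mxE.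
have rowU i : (row i U *m (row i U)^T) 0 0 = 1.
  by have := conj_diagE 1%:M U i; rewrite !mulmx1 Uo.1 mxE eqxx => <-.
have bound B i : possemidef B -> A *m pseudoinverse B *m B = A -> d 0 i != 0 ->
    (d 0 i)^-1 *+ 2 - (d 0 i)^-1 ^+ 2 * (row i U *m B *m (row i U)^T) 0 0 <= f B i.
  move=> Bpsd APB di0; rewrite /f conj_diagE.
  have := @pinv_quadratic_bound B (row i U) (d 0 i)^-1 Bpsd.
  rewrite rowU mulr1; apply.
  (* Row i of [U] is a multiple of its image under [A], hence inherits A B^+ B = A. *)
  apply: (scalerI di0); rewrite -rowA -[in RHS]APB !mulmxA.
  by rewrite rowA -!scalemxAl.
apply: (@le_trans _ _ (lpnorm q (fun i => a * f A1 i + b * f A2 i))).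
  rewrite AE' (mzeta_lpnorm Uo q1 d0); apply: le_lpnorm => [|i|i]; first by lra.
    by rewrite invr_ge0.
  have [->|di0] := eqVneq (d 0 i) 0.
    by rewrite invr0 addr_ge0// mulr_ge0// f_ge0.
  have := ler_wpM2l a0 (bound _ i A1psd (quot _ ker1) di0).
  have := ler_wpM2l b0 (bound _ i A2psd (quot _ ker2) di0).
  have : a * (row i U *m A1 *m (row i U)^T) 0 0
       + b * (row i U *m A2 *m (row i U)^T) 0 0 = d 0 i.
    transitivity ((row i U *m A *m (row i U)^T) 0 0).
      rewrite AE mulmxDr mulmxDl -!scalemxAr -!scalemxAl.
      by rewrite [in RHS]mxE; congr (_ + _); rewrite [in RHS]mxE.
    by rewrite rowA -scalemxAl mxE rowU mulr1.
  set x1 := (row i U *m A1 *m _) 0 0; set x2 := (row i U *m A2 *m _) 0 0.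
  move=> xE; set D := d 0 i in xE di0 *.
  (* Averaging the two bounds gives 2/D minus this quantity, that is 1/D. *)
  have tE : D^-1 ^+ 2 * (a * x1 + b * x2) = D^-1.
    by rewrite xE; field.
  have bE : b = 1 - a by lra.
  move: tE; rewrite bE; set t := D^-1; nra.
apply: le_trans (lpnormD q1 _ _) _ => [i|i|]; try by rewrite mulr_ge0// f_ge0.
have qn0 : q != 0 by rewrite gt_eqF//; lra.
rewrite (lpnormZ qn0 a0 (fun i => f_ge0 A1 i A1psd)).
rewrite (lpnormZ qn0 b0 (fun i => f_ge0 A2 i A2psd)).
apply: lerD; apply: ler_wpM2l => //.
  exact: (lpnorm_conj_pinv A1psd Uo q1).
exact: (lpnorm_conj_pinv A2psd Uo q1).
Qed.

End MatrixZeta.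

(** * Graph Laplacians *)

Section Laplacian.
Context {R : realType} {n : nat}.
Implicit Types G : wgraph R n.

Lemma adjacency_sym G i j : adjacency G i j = adjacency G j i.
Proof. by rewrite !mxE finset.setUC. Qed.

Lemma adjacency_ge0 G i j : 0 <= adjacency G i j.
Proof. by rewrite mxE; case: ifPn => // /(@weight_gt0 _ _ G)/ltW. Qed.

Lemma degreeE G i : degree G i = \sum_j adjacency G i j.
Proof.
under eq_bigr => j _ do rewrite mxE.
rewrite -big_mkcond /= /degree.
pose J := [set j | [set i; j]%SET \in edges G]%SET.
have neq j : j \in J -> j != i.
  rewrite inE => /(@edges_card2 _ _ G); rewrite cards2.
  by case: eqVneq => // <-.
(* The edges at [i] correspond to their other endpoints: [j] maps to {i, j}, injectively because
   there are no loops. *)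
transitivity (\sum_(e in [set [set i; j]%SET | j in J]%SET) weight G e).
  apply: eq_bigl => e; apply/andP/imsetP => [[eE ie]|[j]].
    have /eqP/cards2P[x [y [_ eq_e]]] := edges_card2 eE.
    move: ie; rewrite eq_e !inE => /orP[]/eqP ie.
      by exists y; rewrite ?inE ie -?eq_e.
    by exists x; rewrite ?inE ie finset.setUC -?eq_e.
  by rewrite inE => jE ->; rewrite jE !inE eqxx.
rewrite big_imset /=; first by apply: eq_bigl => j; rewrite inE.
move=> j k jJ kJ /setP/(_ j); rewrite !inE eqxx orbT (negbTE (neq j jJ)) /=.
by move=> /esym/eqP.
Qed.

Lemma laplacianE G : laplacian G
  = diag_mx (\row_i \sum_j adjacency G i j) - adjacency G.
Proof.
rewrite /laplacian; congr (diag_mx _ - _).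
by apply/rowP => i; rewrite !mxE degreeE.
Qed.

Lemma laplacian_mul G (x : 'cV[R]_n) i :
  (laplacian G *m x) i 0 = \sum_j adjacency G i j * (x i 0 - x j 0).
Proof.
rewrite laplacianE mulmxBl mul_diag_mx [LHS]mxE [in X in X + _]mxE [in X in X + _]mxE.
rewrite [X in _ + X]mxE mulr_suml [X in - X]mxE -sumrB.
by apply: eq_bigr => j _; rewrite mulrBr.
Qed.

(** Expanding gives a sum that is not symmetric in i and j; averaging it with its copy under the
    exchange of i and j produces the squares. *)
Lemma laplacian_quadratic G (x : 'cV[R]_n) :
  (x^T *m laplacian G *m x) 0 0
  = 2^-1 * \sum_i \sum_j adjacency G i j * (x i 0 - x j 0) ^+ 2.
Proof.
have -> : (x^T *m laplacian G *m x) 0 0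
    = \sum_i \sum_j adjacency G i j * (x i 0 * (x i 0 - x j 0)).
  rewrite -mulmxA mxE; apply: eq_bigr => i _; rewrite laplacian_mul mxE mulr_sumr.
  by apply: eq_bigr => j _; rewrite mulrCA.
set S := LHS; have SE : S = \sum_i \sum_j adjacency G i j * (x j 0 * (x j 0 - x i 0)).
  rewrite /S exchange_big /=; apply: eq_bigr => i _; apply: eq_bigr => j _.
  by rewrite adjacency_sym.
have -> : S = 2^-1 * (S + S) by field.
congr (_ * _); rewrite {2}SE -big_split /=; apply: eq_bigr => i _.
rewrite -big_split /=; apply: eq_bigr => j _; ring.
Qed.

Lemma laplacian_psd G : possemidef (laplacian G).
Proof.
split=> [|x].
  rewrite laplacianE linearB /= tr_diag_mx; congr (_ - _).
  by apply/matrixP => i j; rewrite mxE adjacency_sym.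
rewrite laplacian_quadratic mulr_ge0 ?invr_ge0//.
apply: sumr_ge0 => i _; apply: sumr_ge0 => j _.
by rewrite mulr_ge0 ?adjacency_ge0 ?sqr_ge0.
Qed.

Lemma laplacian_const G (c : R) : laplacian G *m const_mx c = 0 :> 'cV[R]_n.
Proof.
apply/colP => i; rewrite laplacian_mul [RHS]mxE big1// => j _.
by rewrite !mxE subrr mulr0.
Qed.

(** The quadratic form vanishes at [x], so each of its nonnegative terms does; [x] is then constant
    along every edge, hence along paths. *)
Lemma laplacian_ker G (x : 'cV[R]_n) : laplacian G *m x = 0 ->
  forall i j, x i 0 = x j 0.
Proof.
move=> Lx0 i j; have := laplacian_quadratic G x.
rewrite -mulmxA Lx0 mulmx0 [LHS]mxE => /esym/eqP.
have term_ge0 (k l : 'I_n) : 0 <= adjacency G k l * (x k 0 - x l 0) ^+ 2.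
  by rewrite mulr_ge0 ?adjacency_ge0 ?sqr_ge0.
rewrite mulf_eq0 invr_eq0 pnatr_eq0 /= psumr_eq0; last first.
  by move=> k _; apply: sumr_ge0.
move=> /allP edge0.
have step (k l : 'I_n) : [set k; l]%SET \in edges G -> x k 0 = x l 0.
  move=> klE; have := edge0 k (mem_index_enum _); rewrite psumr_eq0//.
  move=> /allP/(_ l (mem_index_enum _)).
  rewrite mulf_eq0 sqrf_eq0 subr_eq0 => /orP[|/eqP//].
  by rewrite mxE klE gt_eqF ?weight_gt0.
have /connectP[s] := edges_connected G i j.
elim: s i => [|k s IH] i /=; first by move=> _ ->.
by move=> /andP[/step -> /IH].
Qed.

(** All Laplacians of connected graphs share the kernel of constant vectors; this supplies the
    kernel hypotheses of [mzeta_root_convex]. *)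
Lemma laplacian_ker_mx G1 G2 (M : 'M[R]_n) :
  laplacian G1 *m M = 0 -> laplacian G2 *m M = 0.
Proof.
move=> L1M; apply/trmx_inj/row_matrixP => j; rewrite -tr_col trmx0 row0.
rewrite colE -mulmxA -colE; apply/trmx_inj; rewrite trmxK trmx0.
have : laplacian G1 *m col j M = 0 by rewrite colE mulmxA L1M mul0mx.
move=> /laplacian_ker const; apply/colP => i.
rewrite (_ : col j M = const_mx (col j M i 0)) ?laplacian_const//.
by apply/colP => k; rewrite [RHS]mxE.
Qed.

(** Together with [laplacian_add], this realizes positive multiples and convex combinations by
    actual graphs, on which the value of a measure is prescribed. *)
Lemma laplacian_scale G (c : R) : 0 < c ->
  exists G', laplacian G' = c *: laplacian G.
Proof.
move=> c0; have cw_gt0 e : e \in edges G -> 0 < c * weight G e.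
  by move=> eE; rewrite mulr_gt0// weight_gt0.
pose G' := WGraph (@edges_card2 _ _ G) (@edges_connected _ _ G) cw_gt0.
exists G'; have adjE : adjacency G' = c *: adjacency G.
  by apply/matrixP => i j; rewrite !mxE /=; case: ifP; rewrite ?mulr0.
rewrite !laplacianE adjE scalerBr; congr (_ - _); rewrite -linearZ /=.
congr diag_mx; apply/rowP => i; rewrite !mxE mulr_sumr.
by apply: eq_bigr => j _; rewrite mxE.
Qed.

Lemma laplacian_add G1 G2 :
  exists G, laplacian G = laplacian G1 + laplacian G2.
Proof.
(* On the union of the edge sets the weights add up, an absent edge counting as 0. *)
pose w e := (if e \in edges G1 then weight G1 e else 0)
          + (if e \in edges G2 then weight G2 e else 0).
have card2 e : e \in edges G1 :|: edges G2 -> #|e| = 2%N.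
  by rewrite inE => /orP[]; exact: edges_card2.
have conn i j : connect (fun u v => [set u; v]%SET \in edges G1 :|: edges G2) i j.
  apply: connect_sub (edges_connected G1 i j) => u v uv.
  by apply: connect1; rewrite inE uv.
have w_gt0 e : e \in edges G1 :|: edges G2 -> 0 < w e.
  rewrite inE /w; case: ifP => [e1 _|_ /= e2].
    rewrite ltr_pwDl ?weight_gt0//.
    by case: ifP => // e2; rewrite ltW ?weight_gt0.
  by rewrite e2 add0r weight_gt0.
exists (WGraph card2 conn w_gt0); set G := WGraph _ _ _.
have adjE : adjacency G = adjacency G1 + adjacency G2.
  apply/matrixP => i j; rewrite !mxE /= inE /w.
  by case: (_ \in edges G1); case: (_ \in edges G2); rewrite //= ?addr0 ?add0r.
rewrite !laplacianE adjE opprD addrACA; congr (_ + _); rewrite -linearD /=.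
congr diag_mx; apply/rowP => i; rewrite !mxE -big_split /=.
by apply: eq_bigr => j _; rewrite mxE.
Qed.

End Laplacian.

(** * Spectrum of a connected Laplacian and the limit of the zeta roots *)

Section ZetaRoot.
Context {R : realType} {n : nat} (n2 : (2 <= n)%N).
Implicit Types G : wgraph R n.

Lemma mzetaZ (A : 'M[R]_n) (c q : R) : possemidef A -> 0 < c -> 1 <= q ->
  mzeta (c *: A) q `^ q^-1 = c^-1 * mzeta A q `^ q^-1.
Proof.
move=> /psd_spectral[U [d [Uo d0 ->]]] c0 q1.
have -> : c *: (U^T *m diag_mx d *m U) = U^T *m diag_mx (c *: d) *m U.
  by rewrite linearZ /= -scalemxAr -scalemxAl.
have cd0 i : 0 <= (c *: d) 0 i by rewrite mxE mulr_ge0// ltW.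
have dV0 i : 0 <= (d 0 i)^-1 by rewrite invr_ge0.
have cV0 : 0 <= c^-1 by rewrite invr_ge0 ltW.
have qn0 : q != 0 by rewrite gt_eqF//; lra.
transitivity (lpnorm q (fun i => ((c *: d) 0 i)^-1)); first exact: mzeta_lpnorm.
rewrite (mzeta_lpnorm Uo q1 d0).
apply: etrans (lpnormZ qn0 cV0 dV0).
by congr lpnorm; apply/funext => i; rewrite mxE invfM.
Qed.

(** At most one: rows of [U] for the eigenvalue 0 are constant, and two constant unit vectors are
    never orthogonal. At least one: otherwise [U] would annihilate the all-ones vector. *)
Lemma count0_eigvals_laplacian G : count (pred1 0) (eigvals (laplacian G)) = 1%N.
Proof.
have [U [d [Uo d0 LE]]] := psd_spectral (laplacian_psd G).
have UL : U *m laplacian G = diag_mx d *m U by rewrite LE !mulmxA Uo.1 mul1mx.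
have LU : laplacian G *m U^T = U^T *m diag_mx d.
  by rewrite LE -mulmxA Uo.1 mulmx1.
rewrite LE (permP (eigvals_spectral d Uo)) count_map.
have -> : count (preim (d 0) (pred1 0)) (enum 'I_n) = #|[pred i | d 0 i == 0]|.
  by rewrite cardE -size_filter enumT /enum_mem.
apply/eqP; rewrite eqn_leq; apply/andP; split.
  apply/card_le1_eqP => i j; rewrite !inE => /eqP di /eqP dj.
  have const k : d 0 k = 0 -> exists c, forall l, U k l = c.
    move=> dk; have : laplacian G *m col k U^T = 0.
      rewrite colE mulmxA LU -mulmxA.
      rewrite (_ : diag_mx d *m _ = 0) ?mulmx0//.
      apply/colP => l; rewrite mul_diag_mx !mxE.
      by case: eqVneq => [->|]; rewrite ?dk ?mul0r ?mulr0.
    move=> /laplacian_ker h; exists (U k (Ordinal (ltnW n2))) => l.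
    by have := h l (Ordinal (ltnW n2)); rewrite !mxE.
  have [ci ciE] := const i di; have [cj cjE] := const j dj.
  have dot k l ck cl : (forall m, U k m = ck) -> (forall m, U l m = cl) ->
      (ck * cl) *+ n = (k == l)%:R.
    move=> kE lE; have /matrixP/(_ k l) := Uo.1; rewrite [RHS]mxE => <-.
    rewrite mxE (eq_bigr (fun=> ck * cl)) ?sumr_const ?card_ord// => m _.
    by rewrite [U^T _ _]mxE kE lE.
  apply/eqP; apply/negPn/negP => ij.
  have := dot i i _ _ ciE ciE; have := dot j j _ _ cjE cjE.
  have := dot i j _ _ ciE cjE; rewrite [i == j]eq_sym (negbTE ij) !eqxx => /eqP.
  rewrite mulrn_eq0 mulf_eq0 => /or3P[|/eqP->|/eqP->].
  - by move=> /eqP n0; move: n2; rewrite n0.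
  - by rewrite mul0r mul0rn => _ /eqP; rewrite eq_sym oner_eq0.
  - by rewrite mul0r mul0rn => /eqP; rewrite eq_sym oner_eq0.
apply/card_gt0P.
have [/existsP[i di]|/existsPn dN] := boolP [exists i, d 0 i == 0].
  by exists i.
have : U *m (const_mx 1 : 'cV[R]_n) = 0.
  have : diag_mx d *m (U *m const_mx 1) = 0 :> 'cV[R]_n.
    by rewrite mulmxA -UL -mulmxA laplacian_const mulmx0.
  move=> /colP h; apply/colP => i; have := h i.
  rewrite mul_diag_mx mxE [RHS]mxE => /eqP.
  by rewrite mulf_eq0 (negbTE (dN i)) /= => /eqP ->; rewrite mxE.
move=> /(congr1 (mulmx U^T)); rewrite mulmxA Uo.2 mul1mx mulmx0.
move=> /colP/(_ (Ordinal (ltnW n2)))/eqP; rewrite !mxE oner_eq0//.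
Qed.

(** A sorted nonnegative list with exactly one zero starts with it. In particular [lambda2] reads a
    genuine entry and not the default value of [nth]. *)
Lemma eigvals_laplacian G : exists s,
  [/\ eigvals (laplacian G) = [:: 0, lambda2 G & s], 0 < lambda2 G,
      all (>= lambda2 G) s & (size s).+2 = n].
Proof.
have Lsym := (laplacian_psd G).1; have [s_sorted cE] := eigvalsP Lsym.
have [U [d [Uo d0 LE]]] := psd_spectral (laplacian_psd G).
have s_perm := eigvals_spectral d Uo; rewrite -LE in s_perm.
have s_ge0 l : l \in eigvals (laplacian G) -> 0 <= l.
  by rewrite (perm_mem s_perm) => /mapP[i _ ->].
have s_size : size (eigvals (laplacian G)) = n.
  by rewrite (perm_size s_perm) size_map size_enum_ord.
have := count0_eigvals_laplacian G; rewrite /lambda2.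
move: s_sorted s_ge0 s_size; case: (eigvals _) => [|x [|y s]] /=.
- by move=> _ _ n0; move: n2; rewrite -n0.
- by move=> _ _ n0; move: n2; rewrite -n0.
move=> /andP[xy ys] ge0 sn count1; exists s.
have ally : all (>= y) s by exact: order_path_min le_trans ys.
have x_ge0 : 0 <= x by apply: ge0; rewrite mem_head.
have y_neq0 : y != 0.
  apply: contraPneq count1 => y0; have x0 : x = 0.
    by apply/le_anti; rewrite x_ge0 -y0 xy.
  by rewrite x0 y0 eqxx.
have y_gt0 : 0 < y by rewrite lt_def y_neq0 (le_trans x_ge0).
(* Otherwise the unique zero would lie in [s], whose entries are at least y > 0. *)
have x0 : x = 0.
  apply/eqP; move: count1; case: (x == 0) => //.
  rewrite (negbTE y_neq0) !add0n => s0.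
  have : has (pred1 0) s by rewrite has_count s0.
  move=> /hasP[z zs /eqP z0].
  by have := allP ally z zs; rewrite /= z0 leNgt y_gt0.
by rewrite x0.
Qed.

Lemma zeta_root_cvg G : zeta G q `^ q^-1 @[q --> +oo] --> (lambda2 G)^-1.
Proof.
have [s [sE l2 ls sn]] := eigvals_laplacian G; set l := lambda2 G in sE l2 ls *.
have zE q : zeta G q = l `^ (- q) + \sum_(x <- s) x `^ (- q).
  rewrite /zeta sE !big_cons eqxx /= gt_eqF//; congr (_ + _).
  rewrite -big_filter; congr (\sum_(_ <- _) _); apply/all_filterP.
  by apply: sub_all ls => x /= lx; rewrite gt_eqF// (lt_le_trans l2).
have rootE q : 0 < q -> (l `^ (- q)) `^ q^-1 = l^-1.
  by move=> q0; rewrite -powRrM mulNr mulfV ?gt_eqF// powR_inv1// ltW.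
apply: (@squeeze_cvgr _ _ _ _ (fun=> l^-1) (fun q => n%:R `^ q^-1 * l^-1)).
- near=> q; have q0 : 0 < q by near: q; apply: nbhs_pinfty_gt; exact: num_real.
  have s0 : 0 <= \sum_(x <- s) x `^ (- q).
    by apply: sumr_ge0 => x _; exact: powR_ge0.
  rewrite -(rootE q q0) -powRM ?powR_ge0// zE; apply/andP; split.
    apply: ge0_ler_powR; rewrite ?invr_ge0 ?(ltW q0) ?nnegrE ?addr_ge0 ?powR_ge0//.
    by rewrite lerDl.
  apply: ge0_ler_powR;
    rewrite ?invr_ge0 ?(ltW q0) ?nnegrE ?addr_ge0 ?mulr_ge0 ?powR_ge0//.
  have : \sum_(x <- s) x `^ (- q) <= \sum_(x <- s) l `^ (- q).
    rewrite big_seq [leRHS]big_seq; apply: ler_sum => x /(allP ls) /= lx.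
    rewrite !powRN lef_pV2 ?posrE ?powR_gt0 ?(lt_le_trans l2)//.
    by apply: ge0_ler_powR; rewrite ?nnegrE ?(ltW q0) ?(ltW l2) ?(le_trans (ltW l2)).
  rewrite big_const_seq count_predT iter_addr_0 => /(lerD (lexx (l `^ (- q)))).
  (* There are n - 1 nonzero eigenvalues; the cruder factor n suffices for the limit. *)
  move=> /le_trans; apply; rewrite -mulrS -[leLHS]mulr_natl ler_wpM2r ?powR_ge0//.
  by rewrite ler_nat -sn ltnW.
- exact: cvg_cst.
- rewrite -[X in _ --> X]mul1r; apply: cvgMr_tmp.
  by apply: cvg_powR_inv; rewrite ltr0n ltnW.
Unshelve. all: by end_near.
Qed.

Lemma zeta_root_oo G : zeta_root G +oo%E = (lambda2 G)^-1.
Proof. exact/cvg_lim/zeta_root_cvg. Qed.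

(** Passes to the limit once for all three properties: scaling and monotonicity use it with one
    coefficient 0, convexity with both. *)
Lemma zeta_root_le G G1 G2 a b p : (1%:E <= p)%E ->
  (forall q, 1 <= q ->
    zeta G q `^ q^-1 <= a * zeta G1 q `^ q^-1 + b * zeta G2 q `^ q^-1) ->
  zeta_root G p <= a * zeta_root G1 p + b * zeta_root G2 p.
Proof.
case: p => [q||]; [by rewrite lee_fin => q1; apply| |by []].
move=> _ h; rewrite !zeta_root_oo.
have lim12 : a * zeta G1 q `^ q^-1 + b * zeta G2 q `^ q^-1 @[q --> +oo]
    --> a * (lambda2 G1)^-1 + b * (lambda2 G2)^-1.
  apply: cvgD; apply: cvgMl_tmp; exact: zeta_root_cvg.
apply: ler_cvg_to (@zeta_root_cvg G) lim12 _.
near=> q; apply: h; near: q; apply: nbhs_pinfty_ge; exact: num_real.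
Unshelve. all: by end_near.
Qed.

End ZetaRoot.

(** The last clause shows that the [lim] defining [zeta_root] at infinity is a true limit, with the
    announced value. *)
Theorem theorem1 (R : realType) (n : nat) (hn : (2 <= n)%N) (x0 : 'cV[R]_n)
    (p : \bar R) (hp : (1%:E <= p)%E) (k : R) (hk : 0 < k)
    (rho : linsys R n -> R)
    (hrho : forall G : wgraph R n,
       rho (network x0 (laplacian G)) = k * zeta_root G p) :
  [/\ convex_systemic_measure x0 rho,
      orthogonally_invariant x0 rho
    & forall G : wgraph R n,
        k * zeta G q `^ q^-1 @[q --> +oo] --> k / lambda2 G ].
Proof.
have zetaE G q : zeta G q = mzeta (laplacian G) q by [].
have scale (G G' : wgraph R n) c : 0 < c -> laplacian G' = c *: laplacian G ->
    zeta_root G' p <= c^-1 * zeta_root G p.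
  move=> c0 LE; rewrite -[leRHS]addr0 -(mul0r (zeta_root G p)).
  apply: (zeta_root_le hn hp) => q q1; rewrite !zetaE LE mul0r addr0.
  by rewrite (mzetaZ (laplacian_psd G) c0 q1).
split; last 1 first.
- by move=> G; apply: cvgMl_tmp; exact: zeta_root_cvg.
- split.
  + move=> G c c0; have [G' GE] := laplacian_scale G c0.
    rewrite -GE !hrho mulrCA; congr (_ * _); apply/le_anti.
    (* The reverse inequality is [scale] applied to [G] as the multiple of [G'] by 1/c. *)
    rewrite (scale _ _ _ c0 GE) /= ler_pdivrMl// -[c in leRHS]invrK.
    by apply: scale; rewrite ?invr_gt0// GE scalerA mulVf ?gt_eqF// scale1r.
  + move=> G1 G2 G12; rewrite !hrho (ler_pM2l hk).
    rewrite -[leRHS]mul1r -[leRHS]addr0 -(mul0r (zeta_root G2 p)).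
    apply: (zeta_root_le hn hp) => q q1; rewrite mul1r mul0r addr0 !zetaE.
    exact: (le_mzeta_root (laplacian_psd G1) (laplacian_psd G2) q1 G12).
  (* The endpoints are treated apart, since a zero multiple of a Laplacian need not come from a
     connected graph. *)
  + move=> G1 G2 a /andP[]; rewrite le_eqVlt => /predU1P[<- _|a0].
      by rewrite subr0 !scale0r !scale1r !mul0r !mul1r !add0r.
    rewrite le_eqVlt => /predU1P[->|a1].
      by rewrite subrr !scale0r !scale1r !mul0r !mul1r !addr0.
    have b0 : 0 < 1 - a by rewrite subr_gt0.
    have [G1' G1E] := laplacian_scale G1 a0.
    have [G2' G2E] := laplacian_scale G2 b0.
    have [G GE] := laplacian_add G1' G2'; rewrite G1E G2E in GE.
    have ab : a + (1 - a) = 1 by rewrite addrC subrK.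
    rewrite -GE !hrho !(mulrCA _ k) -mulrDr (ler_pM2l hk).
    apply: (zeta_root_le hn hp) => q q1; rewrite !zetaE.
    exact: (mzeta_root_convex q1 (laplacian_psd G1) (laplacian_psd G2)
      (ltW a0) (ltW b0) ab GE (@laplacian_ker_mx _ _ G1 G) (@laplacian_ker_mx _ _ G2 G)).
(* Comparing state matrices turns membership in [networks] into a graph with Laplacian U L U^T. *)
- move=> G U Uo [G' /(congr1 (@sys_A R n))/oppr_inj GE].
  by rewrite GE !hrho /zeta_root /zeta -GE (eigvals_orthogonal _ Uo).
Qed.
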